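(* Let $R$ be a ring, $M$ an $R$-module and $\mathscr{X}$ a class of submodules of $M$ such that $\mathscr{X}_0$ is closed under finite sums and closed under cyclic submodules. Then $M$ is (left) $1$-$\mathscr{X}$-coherent if and only if $(0:_R a)$ is a finitely generated left ideal of $R$ for any $a\in M$ such that $Ra$ is in $\mathscr{X}_0$, and the intersection of any two submodules of $M$ in $\mathscr{X}_0$ is finitely generated.
   Context: Rings are associative with identity (not necessarily commutative); modules are unital left modules. $\mathscr{X}_0$ is the class of finitely generated modules in $\mathscr{X}$ and $\mathscr{X}_1$ the class of finitely presented modules in $\mathscr{X}$. $M$ is $1$-$\mathscr{X}$-coherent if $\mathscr{X}_0$ is nonempty and every module in $\mathscr{X}_0$ is in $\mathscr{X}_1$. A class of submodules is closed under finite sums if for every finite family $\{M_i\}_{i\in I}$ in the class, $\sum_{i\in I}M_i$ is also in the class. It is closed under cyclic submodules if every cyclic submodule of a module in the class is also in the class. $(0:_R a)=\{r\in R : ra=0\}$. *)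

(* Defs.v *)
From HB Require Import structures.
From mathcomp Require Import all_boot all_order all_algebra.
From mathcomp Require Import boolp classical_sets.

Set Implicit Arguments.
Unset Strict Implicit.
Unset Printing Implicit Defensive.

Import GRing.Theory.
Local Open Scope classical_set_scope.
Local Open Scope ring_scope.

Section Submodules.
Context {R : pzRingType} {M : lmodType R}.
Implicit Types (N : set M) (a : M).

Definition is_submodule N : Prop := GRing.submod_closed [in N].

Definition span (n : nat) (g : 'I_n -> M) : set M :=
  [set x | exists c : 'I_n -> R, x = \sum_(i < n) c i *: g i].

Definition cyclic_submodule a : set M := range (fun r : R => r *: a).

Definition annihilator a : set R^o := [set r : R^o | (r : R) *: a = 0].

Definition submodule_sum (n : nat) (F : 'I_n -> set M) : set M :=
  [set x | exists2 y : 'I_n -> M, forall i, F i (y i) & x = \sum_(i < n) y i].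

Definition finitely_generated N : Prop :=
  exists (n : nat) (g : 'I_n -> M), N = span g.

End Submodules.

Section Coherence.
Context {R : pzRingType} {M : lmodType R}.
Implicit Types (N : set M) (X C : set (set M)).

(* A surjection from the free module R^n onto the module N is encoded as a
   linear map into the ambient module M whose image is exactly N. *)
Definition finitely_presented N : Prop :=
  exists (n : nat) (f : {linear 'rV[R]_n -> M}),
    range f = N /\ finitely_generated [set v | f v = 0].

Definition fg_class X : set (set M) := X `&` [set N | finitely_generated N].

Definition fp_class X : set (set M) := X `&` [set N | finitely_presented N].

Definition coherent1 X : Prop :=
  fg_class X !=set0 /\ fg_class X `<=` fp_class X.

(* The empty family (n = 0) is a finite family, so a class closed under finite
   sums contains the zero submodule; in particular it is nonempty. *)
Definition closed_finite_sums C : Prop :=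
  forall (n : nat) (F : 'I_n -> set M),
    (forall i, C (F i)) -> C (submodule_sum F).

Definition closed_cyclic_submodules C : Prop :=
  forall N a, C N -> cyclic_submodule a `<=` N -> C (cyclic_submodule a).

End Coherence.

(* Main.v *)
(** Schanuel's lemma: a surjection from a finitely generated module onto a
    finitely presented one has finitely generated kernel.  For R -> Ra this
    kernel is the annihilator of a; for R^n (+) R^m -> A + B, built from
    generators of A and of B, the image of the kernel in A is the intersection
    of A and B.
    Conversely, the module K of relations between g_0, ..., g_n is finitely
    generated by induction on n: projecting K to its first coordinate has as
    kernel the relations between g_1, ..., g_n and as image the left ideal
    {r | r g_0 \in <g_1, ..., g_n>}; multiplication by g_0 maps this ideal onto
    the intersection of R g_0 and <g_1, ..., g_n>, with kernel the annihilator
    of g_0. *)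
From HB Require Import structures.
Require Import Defs.
From mathcomp Require Import all_boot all_order all_algebra.
From mathcomp Require Import boolp classical_sets.

Set Implicit Arguments.
Unset Strict Implicit.
Unset Printing Implicit Defensive.

Local Open Scope classical_set_scope.
Import GRing.Theory.
Local Open Scope ring_scope.

(** * Linear combinations, scalings and coordinates as linear maps *)

Definition lincomb {R : pzRingType} {M : lmodType R} {n : nat}
  (g : 'I_n -> M) (c : 'rV[R]_n) : M := \sum_(i < n) c 0 i *: g i.

Lemma lincomb_linear (R : pzRingType) (M : lmodType R) (n : nat)
  (g : 'I_n -> M) : linear (lincomb g).
Proof.
move=> a u v; rewrite /lincomb scaler_sumr -big_split /=.
by apply: eq_bigr => i _; rewrite !mxE scalerDl scalerA.
Qed.

HB.instance Definition _ (R : pzRingType) (M : lmodType R) (n : nat)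
  (g : 'I_n -> M) :=
  GRing.isLinear.Build R 'rV[R]_n M _ (lincomb g) (@lincomb_linear R M n g).

(** The domain is [R^o], the ring as a left module over itself, so that the image is
    [cyclic_submodule a] and the kernel is [annihilator a]. *)
Definition scale_vec {R : pzRingType} {M : lmodType R} (a : M) (r : R^o) : M :=
  (r : R) *: a.

Lemma scale_vec_linear (R : pzRingType) (M : lmodType R) (a : M) :
  linear (scale_vec a).
Proof. by move=> k r s; rewrite /scale_vec scalerDl scalerA. Qed.

HB.instance Definition _ (R : pzRingType) (M : lmodType R) (a : M) :=
  GRing.isLinear.Build R R^o M _ (scale_vec a) (@scale_vec_linear R M a).

Definition coordinate {R : pzRingType} {n : nat} (i : 'I_n) (v : 'rV[R]_n) : R^o :=
  v 0 i.

Lemma coordinate_linear (R : pzRingType) (n : nat) (i : 'I_n) :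
  linear (@coordinate R n i).
Proof. by move=> k u v; rewrite /coordinate !mxE. Qed.

HB.instance Definition _ (R : pzRingType) (n : nat) (i : 'I_n) :=
  GRing.isLinear.Build R 'rV[R]_n R^o _ (@coordinate R n i)
    (@coordinate_linear R n i).

Lemma span_lincomb (R : pzRingType) (M : lmodType R) (n : nat) (g : 'I_n -> M) :
  Defs.span g = range (lincomb g).
Proof.
apply/seteqP; split => [x [c ->]|x [c _ <-]]; last by exists (c 0).
by exists (\row_i c i) => //; apply: eq_bigr => i _; rewrite mxE.
Qed.

Lemma lincomb_delta (R : pzRingType) (M : lmodType R) (n : nat) (g : 'I_n -> M)
  (i : 'I_n) : lincomb g (delta_mx 0 i) = g i.
Proof.
rewrite /lincomb (bigD1 i) //= mxE !eqxx scale1r big1 ?addr0 // => j ji.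
by rewrite mxE (negbTE ji) andbF scale0r.
Qed.

Lemma linear_lincomb (R : pzRingType) (V W : lmodType R) (f : {linear V -> W})
  (n : nat) (g : 'I_n -> V) (c : 'rV[R]_n) :
  f (lincomb g c) = lincomb (f \o g) c.
Proof. by rewrite linear_sum; apply: eq_bigr => i _; rewrite linearZ. Qed.

Lemma linear_rV (R : pzRingType) (W : lmodType R) (n : nat)
  (f : {linear 'rV[R]_n -> W}) (c : 'rV[R]_n) :
  f c = lincomb (fun i => f (delta_mx 0 i)) c.
Proof.
by rewrite {1}(row_sum_delta c) linear_sum; apply: eq_bigr => i _; rewrite linearZ.
Qed.

(** * Submodules and finite generation under images, sums and extensions *)

Lemma submodule_lincomb (R : pzRingType) (V : lmodType R) (N : set V) (n : nat)
  (g : 'I_n -> V) (c : 'rV[R]_n) :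
  is_submodule N -> (forall i, N (g i)) -> N (lincomb g c).
Proof.
move=> [N0 ND] Ng; rewrite /lincomb; elim/big_rec: _ => [|i x _ Nx].
  exact/set_mem.
by apply/set_mem/ND; apply/mem_set.
Qed.

Lemma submodule_add_scale (R : pzRingType) (V : lmodType R) (N : set V) (k : R)
  (x y : V) : is_submodule N -> N x -> N y -> N (k *: x + y).
Proof. by move=> [_ ND] Nx Ny; apply/set_mem/ND; apply/mem_set. Qed.

Lemma kernel_submodule (R : pzRingType) (V W : lmodType R)
  (f : {linear V -> W}) : is_submodule [set v | f v = 0].
Proof.
split=> [|k x y /set_mem fx /set_mem fy]; apply/mem_set => /=.
  exact: linear0.
by rewrite linearP fx fy scaler0 addr0.
Qed.

Lemma image_submodule (R : pzRingType) (V W : lmodType R)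
  (f : {linear V -> W}) (N : set V) : is_submodule N -> is_submodule (f @` N).
Proof.
move=> NS; split=> [|k _ _ /set_mem [x Nx <-] /set_mem [y Ny <-]].
  by apply/mem_set; exists 0; [exact/set_mem/NS.1 | exact: linear0].
apply/mem_set; exists (k *: x + y); last exact: linearP.
exact: submodule_add_scale.
Qed.

Lemma finitely_generated_rV (R : pzRingType) (n : nat) :
  finitely_generated [set: 'rV[R]_n].
Proof.
exists n, (fun i => delta_mx 0 i); apply/seteqP; split=> // v _.
by exists (v 0); rewrite {1}(row_sum_delta v).
Qed.

Lemma finitely_generated_image (R : pzRingType) (V W : lmodType R)
  (f : {linear V -> W}) (N : set V) :
  finitely_generated N -> finitely_generated (f @` N).
Proof.
move=> [n [g ->]]; exists n, (f \o g); rewrite !span_lincomb.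
by rewrite image_comp; apply: eq_imagel => c _; exact: linear_lincomb.
Qed.

Lemma finitely_generated_add (R : pzRingType) (V : lmodType R) (A B : set V) :
  finitely_generated A -> finitely_generated B ->
  finitely_generated [set x + y | x in A & y in B].
Proof.
move=> [n [g ->]] [m [h ->]].
exists (n + m)%N, (fun i => match split i with inl j => g j | inr k => h k end).
have E (c : 'I_(n + m) -> R) : \sum_i c i *:
    match split i with inl j => g j | inr k => h k end =
    \sum_i c (lshift m i) *: g i + \sum_i c (rshift n i) *: h i.
  rewrite big_split_ord /=; congr (_ + _); apply: eq_bigr => i _.
    by rewrite (unsplitK (inl i)).
  by rewrite (unsplitK (inr i)).
apply/seteqP; split=> [_ [_ [c ->]] [_ [d ->] <-]|_ [c ->]].
  exists (fun i => match split i with inl j => c j | inr k => d k end).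
  rewrite E; congr (_ + _); apply: eq_bigr => i _.
    by rewrite (unsplitK (inl i)).
  by rewrite (unsplitK (inr i)).
rewrite E; exists (\sum_i c (lshift m i) *: g i).
  by exists (fun i => c (lshift m i)).
by exists (\sum_i c (rshift n i) *: h i) => //; exists (fun i => c (rshift n i)).
Qed.

(** Lift generators of the image to elements of [N]. Subtracting a suitable combination of the lifts
    moves any element of [N] into the kernel, so the lifts and the generators of the kernel part
    together generate [N]. *)
Lemma finitely_generated_extension (R : pzRingType) (V W : lmodType R)
  (f : {linear V -> W}) (N : set V) :
  is_submodule N -> finitely_generated (f @` N) ->
  finitely_generated (N `&` [set v | f v = 0]) -> finitely_generated N.
Proof.
move=> NS [n [g fN]] kfg.
have /choice [x xP] i : exists x, N x /\ f x = g i.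
  have : (f @` N) (g i).
    by rewrite fN span_lincomb; exists (delta_mx 0 i); rewrite ?lincomb_delta.
  by move=> [x Nx fx]; exists x.
have fx : f \o x = g by apply/funext => i; case: (xP i).
have Nx c : N (lincomb x c) by apply: submodule_lincomb => // i; case: (xP i).
suff -> : N = [set y + z | y in Defs.span x & z in N `&` [set v | f v = 0]].
  by apply: finitely_generated_add => //; exists n, x.
rewrite span_lincomb; apply/seteqP; split=> [v Nv|_ [_ [c _ <-]] [z [Nz _] <-]].
  have : (f @` N) (f v) by exists v.
  rewrite fN span_lincomb => -[c _ fv].
  exists (lincomb x c); first by exists c.
  exists (v - lincomb x c); last by rewrite addrC subrK.
  split; first by rewrite addrC -scaleN1r; exact: submodule_add_scale.
  by rewrite /= linearB /= linear_lincomb fx fv subrr.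
by rewrite -[lincomb x c]scale1r; exact: submodule_add_scale.
Qed.

(* If h lifts the presentation f through g, and the w_j are preimages under f of
   the g (b_j), then ker g is the sum of h (ker f) and the span of the
   b_j - h (w_j). *)
Lemma finitely_presented_kernel (R : pzRingType) (V M : lmodType R) (N : set M)
  (g : {linear V -> M}) :
  finitely_presented N -> finitely_generated [set: V] -> range g = N ->
  finitely_generated [set v | g v = 0].
Proof.
move=> [n [f [fN kf]]] [m [b bV]] gN.
have /choice [h hP] i : exists v, g v = f (delta_mx 0 i).
  have : range g (f (delta_mx 0 i)) by rewrite gN -fN; exists (delta_mx 0 i).
  by move=> [v _ <-]; exists v.
have gh c : g (lincomb h c) = f c.
  rewrite linear_lincomb (linear_rV f); congr (lincomb _ c).
  by apply/funext => i /=.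
have /choice [w wP] j : exists c, f c = g (b j).
  have : range f (g (b j)) by rewrite fN -gN; exists (b j).
  by move=> [c _ <-]; exists c.
pose e j := b j - lincomb h (w j).
have eE c : lincomb b c = lincomb h (lincomb w c) + lincomb e c.
  rewrite linear_lincomb -[RHS]big_split; apply: eq_bigr => j _ /=.
  by rewrite -scalerDr /e addrC subrK.
have ge c : g (lincomb e c) = 0.
  rewrite linear_lincomb; apply: big1 => j _ /=.
  by rewrite linearB /= gh wP subrr scaler0.
suff -> : [set v | g v = 0] =
    [set x + y | x in lincomb h @` [set c | f c = 0] & y in Defs.span e].
  apply: finitely_generated_add; first exact: finitely_generated_image.
  by exists m, e.
rewrite span_lincomb; apply/seteqP; split=> [v /= gv|].
  have : [set: V] v by [].
  rewrite bV span_lincomb => -[c _ vE].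
  exists (lincomb h (lincomb w c)); last first.
    by exists (lincomb e c); [exists c | rewrite -eE].
  (* As [g] kills [lincomb e c], the equation [g v = 0] says exactly that [f] kills
     [lincomb w c]. *)
  exists (lincomb w c) => //=.
  by move: gv; rewrite -vE eE linearD /= gh ge addr0.
move=> _ [_ [c /= fc <-]] [_ [d _ <-] <-] /=.
by rewrite linearD /= gh ge fc addr0.
Qed.

(** * Modules of relations *)

(** Through this identity, closure under finite sums puts a span in [fg_class X] as soon as its
    generators span cyclic members of the class. *)
Lemma sum_cyclic_span (R : pzRingType) (M : lmodType R) (n : nat)
  (g : 'I_n -> M) : submodule_sum (fun i => cyclic_submodule (g i)) = Defs.span g.
Proof.
apply/seteqP; split=> [_ [y yP ->]|_ [c ->]].
  have /choice [c cP] i : exists r, r *: g i = y i.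
    by case: (yP i) => r _ <-; exists r.
  by exists c; apply: eq_bigr => i _; rewrite cP.
by exists (fun i => c i *: g i) => // i; exists (c i).
Qed.

Lemma lincomb_cons (R : pzRingType) (M : lmodType R) (n : nat)
  (g : 'I_n.+1 -> M) (c : 'rV[R]_n.+1) :
  lincomb g c =
  c 0 0 *: g 0 + lincomb (fun i => g (lift 0 i)) (\row_i c 0 (lift 0 i)).
Proof.
rewrite {1}/lincomb big_ord_recl; congr (_ + _).
by apply: eq_bigr => i _; rewrite mxE.
Qed.

(** Embeds the relations between the last [n] generators into those between all [n.+1] of them, as
    the relations with first coordinate zero. *)
Definition cons0 {R : pzRingType} {n : nat} (c : 'rV[R]_n) : 'rV[R]_n.+1 :=
  \row_j (if unlift 0 j is Some i then c 0 i else 0).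

Lemma cons0_linear (R : pzRingType) (n : nat) : linear (@cons0 R n).
Proof.
move=> k u v; apply/rowP => j; rewrite !mxE.
by case: unlift => [i|]; rewrite ?mxE // mulr0 addr0.
Qed.

HB.instance Definition _ (R : pzRingType) (n : nat) :=
  GRing.isLinear.Build R 'rV[R]_n 'rV[R]_n.+1 _ (@cons0 R n) (@cons0_linear R n).

Lemma cons0_lift (R : pzRingType) (n : nat) (c : 'rV[R]_n) (i : 'I_n) :
  cons0 c 0 (lift 0 i) = c 0 i.
Proof. by rewrite mxE liftK. Qed.

Lemma cons0_0 (R : pzRingType) (n : nat) (c : 'rV[R]_n) : cons0 c 0 0 = 0.
Proof. by rewrite mxE unlift_none. Qed.

(** Only the cyclic submodules of the generators are assumed to lie in the class, a condition that
    passes to the tail of [g]; this is what makes the induction work. *)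
Lemma relations_finitely_generated (R : pzRingType) (M : lmodType R)
  (X : set (set M)) (X0_sums : closed_finite_sums (fg_class X))
  (X_ann : forall a : M, fg_class X (cyclic_submodule a) ->
     finitely_generated (annihilator a))
  (X_meet : forall A B : set M, fg_class X A -> fg_class X B ->
     finitely_generated (A `&` B))
  (n : nat) (g : 'I_n -> M) :
  (forall i, fg_class X (cyclic_submodule (g i))) ->
  finitely_generated [set c | lincomb g c = 0].
Proof.
elim: n g => [|n IHn] g Xg.
  suff -> : [set c | lincomb g c = 0] = setT by exact: finitely_generated_rV.
  by apply/seteqP; split=> // c _ /=; rewrite /lincomb big_ord0.
pose g' i := g (lift 0 i).
have Xg' : fg_class X (Defs.span g').
  by rewrite -sum_cyclic_span; apply: X0_sums => i; exact: Xg.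
set K := [set c | _].
have KS : is_submodule K by exact: kernel_submodule.
(* First extension: project the relations to their first coordinate. *)
apply: (finitely_generated_extension (f := coordinate (0 : 'I_n.+1))) => //.
  (* Second extension: multiply the left ideal of first coordinates by [g 0]. *)
  apply: (finitely_generated_extension (f := scale_vec (g 0))).
  - exact: image_submodule.
  - suff -> : scale_vec (g 0) @` (coordinate 0 @` K) =
        cyclic_submodule (g 0) `&` Defs.span g' by exact: X_meet.
    rewrite span_lincomb; apply/seteqP; split.
      move=> _ [_ [c Kc <-] <-]; split; first by exists (c 0 0).
      (* A relation equates its first term with minus the combination of the others, hence the
         sign. *)
      exists (- (\row_i c 0 (lift 0 i))) => //.
      apply/eqP; rewrite linearN /= eqr_oppLR -subr_eq0 opprK.
      by rewrite addrC -lincomb_cons; apply/eqP.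
    move=> _ [[r _ <-] [d _ dE]]; exists r => //.
    (* The row [(r, -d)] is a relation because [r *: g 0 = lincomb g' d]. *)
    exists (r *: delta_mx 0 0 - cons0 d); last first.
      by rewrite /coordinate !mxE unlift_none !eqxx subr0 mulr1.
    rewrite /K /= lincomb_cons; set v := \row_i _.
    have -> : v = - d by apply/rowP => i; rewrite !mxE liftK /= mulr0 sub0r.
    by rewrite !mxE unlift_none !eqxx subr0 mulr1 -dE -linearD /= subrr linear0.
  - suff -> : (coordinate 0 @` K) `&` [set r | scale_vec (g 0) r = 0] =
        annihilator (g 0) by exact: X_ann.
    apply/seteqP; split=> [r [] //|r rg]; split=> //.
    (* If [r] annihilates [g 0], then [(r, 0, ..., 0)] is a relation, so the whole annihilator
       consists of first coordinates of relations. *)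
    exists (r *: delta_mx 0 0); last by rewrite /coordinate !mxE !eqxx mulr1.
    by rewrite /K /= linearZ /= lincomb_delta.
suff -> : K `&` [set c | coordinate 0 c = 0] =
    cons0 @` [set c | lincomb g' c = 0].
  by apply: finitely_generated_image; apply: IHn => i; exact: Xg.
apply/seteqP; split=> [c [Kc c0]|_ [c gc <-]].
  exists (\row_i c 0 (lift 0 i)).
    by move: Kc; rewrite /K /= lincomb_cons [c 0 0]c0 scale0r add0r.
  apply/rowP => j; have [i ->|->] := unliftP 0 j.
    by rewrite cons0_lift mxE.
  by rewrite cons0_0 [c 0 0]c0.
split; last exact: cons0_0.
rewrite /K /= lincomb_cons cons0_0 scale0r add0r -[RHS]gc.
by congr (lincomb _ _); apply/rowP => i; rewrite mxE cons0_lift.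
Qed.

(** * Intersections, and the equivalence *)

Lemma finitely_generated_meet (R : pzRingType) (M : lmodType R) (A B : set M) :
  finitely_generated A -> finitely_generated B ->
  finitely_presented [set x + y | x in A & y in B] ->
  finitely_generated (A `&` B).
Proof.
move=> [n [a ->]] [m [b ->]]; rewrite !span_lincomb => fpAB.
pose f : {linear 'rV[R]_(n + m) -> M} := (lincomb a \o lsubmx)%FUN.
pose g : {linear 'rV[R]_(n + m) -> M} := (lincomb b \o rsubmx)%FUN.
have kfg : finitely_generated [set v | (f \+ g) v = 0].
  apply: finitely_presented_kernel fpAB (finitely_generated_rV _ _) _.
  apply/seteqP; split=> [_ [v _ <-]|_ [_ [c _ <-]] [_ [d _ <-] <-]].
    exists (f v); first by exists (lsubmx v).
    by exists (g v) => //; exists (rsubmx v).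
  by exists (row_mx c d); rewrite //= row_mxKl row_mxKr.
suff -> : range (lincomb a) `&` range (lincomb b) =
    f @` [set v | (f \+ g) v = 0] by exact: finitely_generated_image.
apply/seteqP; split=> [x [[c _ cx] [d _ dx]]|_ [v /= fgv <-]].
  (* The kernel of the sum map pairs equal elements of the two spans up to sign, so the second half
     is negated. *)
  exists (row_mx c (- d)); rewrite /= ?row_mxKl ?row_mxKr //.
  by rewrite linearN /= cx dx subrr.
split; first by exists (lsubmx v).
exists (- rsubmx v) => //; rewrite linearN /=; apply/eqP.
by rewrite eq_sym -subr_eq0 opprK fgv.
Qed.

Lemma submodule_sum2 (R : pzRingType) (M : lmodType R) (F : 'I_2 -> set M) :
  submodule_sum F = [set x + y | x in F 0 & y in F 1].
Proof.
apply/seteqP; split=> [_ [y yF ->]|_ [x xF] [y yF <-]].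
  exists (y 0) => //; exists (y 1) => //.
  by rewrite big_ord_recl big_ord1; congr (_ + y _); exact: val_inj.
exists (fun i => if i == 0 then x else y); last by rewrite big_ord_recl big_ord1.
move=> i; case: eqP => [->//|/eqP i0].
by have -> : i = 1 by apply: val_inj; case: i i0 => [[|[|]]].
Qed.

Theorem theorem2p16 (R : pzRingType) (M : lmodType R) (X : set (set M))
  (X_submod : forall N : set M, X N -> is_submodule N)
  (X0_sums : closed_finite_sums (fg_class X))
  (X0_cyclic : closed_cyclic_submodules (fg_class X)) :
  coherent1 X <->
  (forall a : M, fg_class X (cyclic_submodule a) ->
     finitely_generated (annihilator a)) /\
  (forall A B : set M, fg_class X A -> fg_class X B ->
     finitely_generated (A `&` B)).
Proof.
split=> [[_ fgfp]|[X_ann X_meet]].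
  split=> [a /fgfp [_ fpa]|A B XA XB].
    apply: (finitely_presented_kernel (g := scale_vec a) fpa) => //.
    (* The regular module [R^o] is generated by the single element 1. *)
    exists 1%N, (fun=> 1); apply/seteqP; split=> // r _.
    by exists (fun=> r); rewrite big_ord1 /= [RHS]mulr1.
  apply: finitely_generated_meet XA.2 XB.2 _.
  have := submodule_sum2 (fun i => if i == 0 then A else B).
  rewrite /= => <-; apply: (fgfp _ _).2; apply: X0_sums => i.
  by case: ifP.
(* The sum of the empty family is the member showing that [fg_class X] is nonempty. *)
split; first by exists (submodule_sum (fun _ : 'I_0 => set0)); apply: X0_sums => -[].
move=> N XN; split; first exact: XN.1.
have [_ [n [g NE]]] := XN.
(* Any finite generating family gives the presentation; its kernel is the module of relations. *)
exists n, (lincomb g); split; first by rewrite NE span_lincomb.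
apply: (relations_finitely_generated X0_sums X_ann X_meet) => i.
apply: X0_cyclic XN _ => _ [r _ <-].
rewrite NE span_lincomb; exists (r *: delta_mx 0 i) => //.
by rewrite linearZ /= lincomb_delta.
Qed.
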